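(* Let $(\mathcal{N},M,M')$ be a Petri net system with $\mathcal{N}=(P,T,\mathrm{Pre},\mathrm{Post})$ acyclic and incidence matrix $\mathcal{A}$. Then $(\mathcal{N},M,M')$ admits a cut-off if and only if the marking equation $M'=M+\mathcal{A}\mathbf{v}$ has a solution $\mathbf{x}\in\mathbb{Q}_{\ge 0}^T$ and a solution $\mathbf{y}\in\mathbb{Z}^T$ such that $\mathrm{supp}(\mathbf{y})\subseteq\mathrm{supp}(\mathbf{x})$.
   Context: A Petri net is $\mathcal{N}=(P,T,\mathrm{Pre},\mathrm{Post})$ with finite sets $P$ (places), $T$ (transitions) and matrices $\mathrm{Pre},\mathrm{Post}\in\mathbb{N}^{P\times T}$; its incidence matrix is $\mathcal{A}=\mathrm{Post}-\mathrm{Pre}$. A marking is $M\in\mathbb{N}^P$; $t$ is enabled at $M$ if $M(p)\ge\mathrm{Pre}[p,t]$ for all $p$, and firing yields $M'=M+\mathcal{A}[\cdot,t]$. $M\xrightarrow{*}M'$ means reachability by a finite sequence of firings. A Petri net system is $(\mathcal{N},M,M')$ with markings $M\neq M'$; it admits a cut-off if there is $B\in\mathbb{N}$ with $n\cdot M\xrightarrow{*}n\cdot M'$ for all $n\ge B$. $\mathcal{N}$ is acyclic if the directed graph with vertex set $P\cup T$ and edges $(p,t)$ whenever $\mathrm{Pre}[p,t]>0$ and $(t,p)$ whenever $\mathrm{Post}[p,t]>0$ has no cycle. The support of a vector $\mathbf{v}$ is $\mathrm{supp}(\mathbf{v})=\{t:\mathbf{v}(t)\neq 0\}$. *)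

(* Defs.v *)
From mathcomp Require Import all_boot all_order all_algebra.

Set Implicit Arguments.
Unset Strict Implicit.
Unset Printing Implicit Defensive.

Import Order.TTheory GRing.Theory Num.Theory.
Local Open Scope ring_scope.

(* Pre and Post are plain functions, so that the index sets can be
   arbitrary (possibly empty) finite types. *)
Record petri_net := PetriNet {
  place : finType;
  trans : finType;
  pre : place -> trans -> nat;
  post : place -> trans -> nat
}.

Definition incidence (N : petri_net) (p : place N) (t : trans N) : int :=
  (post p t)%:Z - (pre p t)%:Z.

Notation marking N := {ffun place N -> nat}.

Definition enabled (N : petri_net) (M : marking N) (t : trans N) : bool :=
  [forall p, (pre p t <= M p)%N].

Definition fires (N : petri_net) (M : marking N) (t : trans N)
    (M' : marking N) : bool :=
  enabled M t && [forall p, (M' p)%:Z == (M p)%:Z + incidence p t].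

Definition step (N : petri_net) : rel (marking N) :=
  [rel M M' | [exists t, fires M t M']].

Definition reachable (N : petri_net) (M M' : marking N) : Prop :=
  exists2 s : seq (marking N), path (@step N) M s & M' = last M s.

Definition admits_cutoff (N : petri_net) (M M' : marking N) : Prop :=
  exists B : nat, forall n : nat, (B <= n)%N -> reachable (M *+ n) (M' *+ n).

Definition edge (N : petri_net) : rel (place N + trans N)%type :=
  fun u v => match u, v with
  | inl p, inr t => (0 < pre p t)%N
  | inr t, inl p => (0 < post p t)%N
  | _, _ => false
  end.

(* The empty sequence is a ucycle in MathComp, hence the form of the
   condition. *)
Definition acyclic (N : petri_net) : Prop :=
  forall c : seq (place N + trans N), ucycle (@edge N) c -> c = [::].

(* M' = M + A v, read in the ring R, in which v takes its values. *)
Definition marking_equation (R : nzRingType) (N : petri_net)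
    (M M' : marking N) (v : {ffun trans N -> R}) : Prop :=
  forall p : place N,
    (M' p)%:R = (M p)%:R + \sum_(t : trans N) (incidence p t)%:~R * v t.

(* Main.v *)
(* Two consecutive runs n M ->* n M' and (n+1) M ->* (n+1) M', with firing
   counts v and w, give the integer solution w - v and the rational solution
   (v + w) / (2n + 1), whose support is the union of those of v and w.
   Conversely, let x = z / d with z integral, and write n = k d + r with r < d.
   Then k z + r y solves the marking equation from n M to n M'; for large n it
   is nonnegative because supp y is contained in supp z, and in an acyclic net
   a nonnegative integer solution of the marking equation can be realized by a
   firing sequence. *)

Require Import Defs.
From mathcomp Require Import all_boot all_order all_algebra.
From mathcomp Require Import zify.

Set Implicit Arguments.
Unset Strict Implicit.
Unset Printing Implicit Defensive.

Import Order.TTheory GRing.Theory Num.Theory.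
Local Open Scope ring_scope.

(** Otherwise every element of [S] has a predecessor in [S], and by finiteness the repeated choice
    of predecessors runs into a cycle. *)
Lemma acyclic_source (V : finType) (e : rel V) (S : pred V) (u0 : V) :
    (forall c : seq V, ucycle e c -> c = [::]) -> S u0 ->
  exists2 u, S u & forall v, S v -> ~~ e v u.
Proof.
move=> acyc Su0.
case: (boolP [exists u, S u && [forall v, S v ==> ~~ e v u]]) => [/existsP|].
  case=> u /andP[Su /forallP src]; exists u => // v Sv.
  exact: (implyP (src v)).
rewrite negb_exists => /forallP noS; exfalso.
pose g u := odflt u [pick v | S v && e v u].
have gP u : S u -> S (g u) /\ e (g u) u.
  move=> Su; rewrite /g; case: pickP => [v /andP[]|no] //=.
  have := noS u; rewrite Su /= => /forallPn[v].
  by rewrite negb_imply negbK no.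
have Siter k : S (iter k g u0) by elim: k => [//|k /gP[]].
have /trajectP[i lti loopi] := looping_order g u0.
set c := iter i g u0 in loopi.
(* The walk from [u0] is back at [c] after [order g u0] steps and first met it after [i] steps, so
   [c] returns to itself after the positive difference. *)
have cyc : fcycle g (orbit g c).
  apply/(orbitPcycle 0 3); exists (order g u0 - i).-1.
  by rewrite prednK ?subn_gt0 // -iterD subnK // ltnW.
have subS : {subset orbit g c <= S}.
  by move=> _ /trajectP[j _ ->]; rewrite -iterD; exact: Siter.
(* [g] follows the edges backwards, so the orbit is a cycle of [e] only once reversed. *)
have: rev (orbit g c) = [::].
  apply: acyc; rewrite /ucycle rev_uniq orbit_uniq andbT rev_cycle.
  apply: (sub_in_cycle (P := [in S])) cyc; last exact/allP.
  by move=> u v Su _ /eqP <-; have [] := gP u Su.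
move/(congr1 size); rewrite size_rev size_orbit => /eqP.
by rewrite -leqn0 leqNgt order_gt0.
Qed.

(** Take a source among the transitions with [v] positive and their output places. It is not a
    place, since each such place is fed by such a transition. *)
Lemma acyclic_first_trans (N : petri_net) (v : trans N -> nat) (t0 : trans N) :
    acyclic N -> (0 < v t0)%N ->
  exists2 t, (0 < v t)%N &
    forall p t', (0 < pre p t)%N -> (0 < v t')%N -> post p t' = 0%N.
Proof.
move=> acyc v0.
pose S (u : place N + trans N) := match u with
  | inl p => [exists t, (0 < v t)%N && (0 < post p t)%N]
  | inr t => (0 < v t)%N end.
have [[p|t]] := @acyclic_source _ (@edge N) S (inr t0) acyc v0.
  by case/existsP=> t /andP[vt pt] /(_ (inr t) vt); rewrite /= pt.
move=> vt src; exists t => // p t' pt vt'; apply/eqP; rewrite -leqn0 leqNgt.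
apply/negP=> pt'; have /(_ _)/negP := src (inl p); apply=> //.
by apply/existsP; exists t'; rewrite vt'.
Qed.

Lemma reachable_refl (N : petri_net) (M : marking N) : reachable M M.
Proof. by exists [::]. Qed.

Lemma fires_reachable (N : petri_net) (M M1 M' : marking N) (t : trans N) :
  fires M t M1 -> reachable M1 M' -> reachable M M'.
Proof.
move=> f [s ps ->]; exists (M1 :: s) => //=.
by rewrite ps andbT; apply/existsP; exists t.
Qed.

Lemma reachable_count (N : petri_net) (M M' : marking N) :
  reachable M M' -> exists v : {ffun trans N -> nat},
    marking_equation M M' [ffun t => (v t)%:Z].
Proof.
case=> s; elim: s M => [|M1 s IHs] M /=.
  move=> _ ->; exists [ffun=> 0%N] => p.
  by rewrite big1 ?addr0 // => t _; rewrite !ffunE mulr0.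
case/andP=> /existsP[t /andP[_ /forallP ft]] /IHs{IHs} IH /IH[v Ev].
exists [ffun t' => ((t' == t) + v t')%N] => p.
rewrite Ev; move/eqP: (ft p); rewrite !natz => ->.
under [in RHS]eq_bigr => t' _ do rewrite !ffunE PoszD mulrDr.
rewrite big_split [in RHS](bigD1 t) //=.
rewrite eqxx mulr1 [in RHS]big1 => [|t' /negbTE->].
  by under eq_bigr do rewrite ffunE; rewrite addr0 intz -addrA.
by rewrite mulr0.
Qed.

(* Fire first a transition t still to be fired none of whose input places is
   fed by such a transition: the marking of those places can only decrease
   down to M' >= 0, so it already covers the demand of t. *)
Lemma acyclic_reachable (N : petri_net) (M M' : marking N)
    (v : {ffun trans N -> nat}) :
  acyclic N -> marking_equation M M' [ffun t => (v t)%:Z] -> reachable M M'.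
Proof.
move=> acyc; have [n] := ubnP (\sum_t v t)%N.
elim: n M v => // n IHn M v; rewrite ltnS => le_n Ev.
have [/forallP v0|/forallPn[t0]] := boolP [forall t, v t == 0%N].
  suff -> : M' = M by exact: reachable_refl.
  apply/ffunP=> p; have := Ev p; rewrite big1 => [|t _].
    by rewrite addr0 !natz => -[].
  by rewrite ffunE (eqP (v0 t)) mulr0.
rewrite -lt0n => /(acyclic_first_trans acyc)[t vt first].
have en p : (pre p t <= M p)%N.
  have [->//|] := posnP (pre p t) => pt.
  have := Ev p; rewrite (bigD1 t) //= ffunE intz.
  set rest := \sum_(_ | _) _.
  have le0 : rest <= 0.
    apply: sumr_le0 => t' _; rewrite ffunE intz.
    have [->|vt'] := posnP (v t'); first by rewrite mulr0.
    by rewrite /incidence (first p t') // sub0r mulNr oppr_le0.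
  rewrite /incidence (first p t) // sub0r mulNr -PoszM !natz.
  have := leq_pmulr (pre p t) vt; lia.
(* By [en] the natural subtraction does not truncate. *)
pose M1 : marking N := [ffun p => (M p - pre p t + post p t)%N].
have M1E p : (M1 p)%:Z = (M p)%:Z + incidence p t.
  by rewrite ffunE /incidence; have := en p; lia.
have ft : fires M t M1.
  by apply/andP; split; apply/forallP=> p //; apply/eqP.
apply: (fires_reachable ft); apply: (IHn _ [ffun t' => (v t' - (t' == t))%N]).
  apply: leq_trans le_n; rewrite (bigD1 t) //= [X in (_ < X)%N](bigD1 t) //=.
  rewrite ffunE eqxx.
  under eq_bigr => t' /negbTE ne do rewrite ffunE ne subn0.
  by rewrite -addSn leq_add2r subn1 prednK.
move=> p; rewrite Ev (bigD1 t) //= [in RHS](bigD1 t) //= !ffunE eqxx.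
under [in RHS]eq_bigr => t' /negbTE ne do rewrite !ffunE ne subn0.
under [in LHS]eq_bigr => t' _ do rewrite !ffunE.
have := M1E p; rewrite ffunE !natz => ->; rewrite intz -subzn // mulrBr mulr1.
by rewrite -[RHS]addrA [X in _ = _ + X]addrA subrKC.
Qed.

Lemma common_denominator (T : finType) (x : T -> rat) :
    (forall t, 0 <= x t) ->
  exists2 d : nat, (0 < d)%N & exists z : T -> nat,
    forall t, x t = (z t)%:R / d%:R.
Proof.
move=> x0; exists (\prod_t `|denq (x t)|)%N.
  by apply: prodn_gt0 => t; rewrite absz_gt0 denq_neq0.
exists (fun t => `|numq (x t)| * \prod_(t' | t' != t) `|denq (x t')|)%N => t.
rewrite [X in _ = _ / X%:R](bigD1 t) //= !natrM -mulf_div.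
rewrite divff ?mulr1; last first.
  by rewrite pnatr_eq0 -lt0n prodn_gt0 // => t'; rewrite absz_gt0 denq_neq0.
rewrite -[LHS]divq_num_den !pmulrn !abszE.
by rewrite ger0_norm ?numq_ge0 // gtr0_norm ?denq_gt0.
Qed.

Lemma ffun_mulrnE (T : finType) (L : {ffun T -> nat}) n p :
  (L *+ n) p = (L p * n)%N.
Proof. by rewrite ffunMnE -mulr_natr natn. Qed.

Lemma marking_equation_add (R : nzRingType) (N : petri_net) (M M' : marking N)
    (a b : nat) (v w : {ffun trans N -> R}) :
    marking_equation (M *+ a) (M' *+ a) v ->
    marking_equation (M *+ b) (M' *+ b) w ->
  marking_equation (M *+ (a + b)) (M' *+ (a + b)) (v + w).
Proof.
move=> Ev Ew p; have := congr2 +%R (Ev p) (Ew p).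
rewrite addrACA -big_split !ffun_mulrnE !mulnDr !natrD => ->.
by congr (_ + _); apply: eq_bigr => t _; rewrite ffunE mulrDr.
Qed.

Lemma marking_equation_scale (R : nzRingType) (N : petri_net)
    (M M' : marking N) (a k : nat) (v : {ffun trans N -> R}) :
    marking_equation (M *+ a) (M' *+ a) v ->
  marking_equation (M *+ (a * k)) (M' *+ (a * k)) (v *+ k).
Proof.
move=> Ev; elim: k => [|k IHk].
  move=> p; rewrite muln0 !mulr0n !ffunE big1 ?addr0 // => t _.
  by rewrite ffunE mulr0.
by rewrite mulnS mulrS; exact: marking_equation_add.
Qed.

(** Multiplication by [d] clears the denominators; it is injective on the rationals, as is the
    embedding of the integers. *)
Lemma marking_equation_quotient (N : petri_net) (M M' : marking N) (d : nat)
    (z : trans N -> nat) : (0 < d)%N ->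
  marking_equation M M' [ffun t => (z t)%:R / d%:R : rat] <->
  marking_equation (M *+ d) (M' *+ d) [ffun t => (z t)%:Z].
Proof.
move=> d0; have dU : d%:R != 0 :> rat by rewrite pnatr_eq0 -lt0n.
have eqE p :
    ((M p)%:R + \sum_t (incidence p t)%:~R
                  * [ffun t => (z t)%:R / d%:R : rat] t) * d%:R
    = (((M *+ d) p)%:R
       + \sum_t (incidence p t)%:~R * [ffun t => (z t)%:Z] t)%:~R.
  rewrite ffun_mulrnE rmorphD rmorph_sum /= !natz -pmulrn natrM mulrDl.
  congr (_ + _); rewrite mulr_suml; apply: eq_bigr => t _.
  by rewrite !ffunE intz rmorphM /= -mulrA divfK.
split=> E p.
  apply: (@intr_inj rat); rewrite -eqE -E ffun_mulrnE.
  by rewrite natz -pmulrn natrM.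
apply: (mulIf dU); rewrite eqE -E ffun_mulrnE.
by rewrite natz -pmulrn natrM.
Qed.

Theorem theorem3p3 (N : petri_net) (M M' : marking N)
    (neqMM' : M <> M') (acyclicN : acyclic N) :
  admits_cutoff M M' <->
  exists (x : {ffun trans N -> rat}) (y : {ffun trans N -> int}),
    [/\ forall t : trans N, 0 <= x t,
        marking_equation M M' x,
        marking_equation M M' y
      & 0.-support y \subset 0.-support x].
Proof.
split=> [[B cut]|[x [y [x0 Ex Ey sub]]]].
  have [v Ev] := reachable_count (cut B (leqnn B)).
  have [w Ew] := reachable_count (cut B.+1 (leqnSn B)).
  exists [ffun t => (v t + w t)%:R / (B + B.+1)%:R].
  exists [ffun t => (w t)%:Z - (v t)%:Z].
  split=> [t|||].
  - by rewrite ffunE divr_ge0.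
  - apply/marking_equation_quotient; first by rewrite addnS.
    move=> p; rewrite (marking_equation_add Ev Ew p).
    by congr (_ + _); apply: eq_bigr => t _; rewrite !ffunE.
  - move=> p; have := congr2 (fun a b => b - a) (Ev p) (Ew p).
    rewrite !ffun_mulrnE !mulnS !natrD opprD addrACA -sumrB.
    rewrite addrK => ->.
    rewrite addrK; congr (_ + _); apply: eq_bigr => t _.
    by rewrite !ffunE mulrBr.
  (* If [v t + w t] vanishes, so do both natural numbers, and hence their difference. *)
  apply/subsetP=> t; rewrite !inE !ffunE; apply: contraNneq => /eqP.
  rewrite mulf_eq0 invr_eq0 !pnatr_eq0 addnS orbF addn_eq0.
  by case/andP=> /eqP-> /eqP->.
have [d d0 [z zE]] := common_denominator x0.
have Ez : marking_equation (M *+ d) (M' *+ d) [ffun t => (z t)%:Z].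
  apply/marking_equation_quotient=> // p.
  by rewrite Ex; congr (_ + _); apply: eq_bigr => t _; rewrite ffunE zE.
pose Y := (\sum_t `|y t|)%N.
(* This bound gives [k >= d * Y], which exceeds any possible deficit [r * |y t|], or equals it,
   because [r < d] and [|y t| <= Y]. *)
exists (d * (d * Y))%N => n le_n.
pose k := (n %/ d)%N; pose r := (n %% d)%N.
have v0 t : 0 <= (z t)%:Z *+ k + y t *+ r.
  have [->|yt] := eqVneq (y t) 0; first by rewrite mul0rn addr0 mulrn_wge0.
  (* The inclusion of supports enters here: where [y t] is nonzero, [k * z t] is at least [k]. *)
  have zt : (0 < z t)%N.
    have := subsetP sub t; rewrite !inE zE => /(_ yt).
    by rewrite mulf_eq0 pnatr_eq0 negb_or lt0n => /andP[].
  have le_k : (d * Y <= k)%N by rewrite leq_divRL // mulnC.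
  have lt_r : (r < d)%N by rewrite ltn_mod.
  have le_Y : (`|y t| <= Y)%N by rewrite /Y (bigD1 t) //= leq_addr.
  have le1 : (r * `|y t| <= k * z t)%N.
    apply: leq_trans (leq_pmulr _ zt); apply: leq_trans le_k.
    by rewrite leq_mul // ltnW.
  rewrite -lerBlDr sub0r (le_trans (ler_norm _)) // normrN normrMn -abszE.
  by rewrite -[leLHS]mulr_natl -[leRHS]mulr_natl !natz -!PoszM lez_nat.
(* By [v0] the absolute value changes nothing; it only turns the solution into firing counts. *)
pose u := [ffun t => absz ((z t)%:Z *+ k + y t *+ r)].
apply: (acyclic_reachable (v := u)) => //.
have Ey1 : marking_equation (M *+ 1) (M' *+ 1) y by [].
have := marking_equation_add
  (marking_equation_scale k Ez) (marking_equation_scale r Ey1).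
rewrite mul1n [(d * k)%N]mulnC -divn_eq => E p.
rewrite E; congr (_ + _); apply: eq_bigr => t _.
by rewrite /u !ffunE !ffunMnE ffunE gez0_abs.
Qed.
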